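(* Let $X\subset E$ be a max-plus convex subset of $E$ which is complete with respect to $\mathsf{D}_{\mathbf{hu}}$. Then every lower semicontinuous multivalued map $\Gamma:Y\to X$ with nonempty closed max-plus convex values defined on a paracompact space $Y$ has a continuous selection. Furthermore, if $A\subset Y$ is a closed set, then any continuous selection of the restriction of $\Gamma$ to $A$ extends to a continuous selection of $\Gamma$.
   Context: $E\neq\{0\}$ is an Archimedean Riesz space (real vector lattice; Archimedean means that if $ny\leqslant x$ for all $n\in\mathbb{N}$ then $y\leqslant 0$), and $\mathbf{u}\in E_+$ is a unit: for every $x\in E_+$ there is $n\in\mathbb{N}$ with $x\leqslant n\mathbf{u}$. The topology on $E$ is that of the metric $\mathsf{D}_{\mathbf{hu}}(x,y)=\max\{0,\mathbf{p}_{\mathbf{u}}(x-y)\}+\max\{0,\mathbf{p}_{\mathbf{u}}(y-x)\}$, where $\mathbf{p}_{\mathbf{u}}(x)=\inf\{t\in\mathbb{R}:x\leqslant t\mathbf{u}\}$. The max-plus convex hull of a nonempty $S\subset E$ is the set $[\![S]\!]$ of all elements $(x_1+t_1\mathbf{u})\vee\cdots\vee(x_m+t_m\mathbf{u})$ with $m\ge1$, $x_i\in S$, $t_i\in\mathbb{R}$ and $\max_i t_i=0$; $[\![\emptyset]\!]=\emptyset$. A set $C\subset E$ is max-plus convex if $C=[\![C]\!]$. Paracompact spaces are Hausdorff. A multivalued map $\Gamma:Y\to X$ assigns to each $y\in Y$ a subset $\Gamma y\subset X$; it is lower semicontinuous if $\{y\in Y:\Gamma y\cap V\neq\emptyset\}$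 is open for every open $V\subset X$. A continuous selection of $\Gamma$ is a continuous $f:Y\to X$ with $f(y)\in\Gamma y$ for all $y$. *)

(* Defs.v *)
From HB Require Import structures.
From mathcomp Require Import all_boot all_order all_algebra.
From mathcomp Require Import boolp classical_sets functions cardinality.
From mathcomp Require Import reals topology mathcomp_extra.

Set Implicit Arguments.
Unset Strict Implicit.
Unset Printing Implicit Defensive.

Import Order.TTheory GRing.Theory Num.Theory.

Local Open Scope classical_set_scope.
Local Open Scope ring_scope.

(* Joining Order.Lattice with GRing.Lmodule directly is rejected, because the
   order of Num.RealDomain is already a lattice order on a Zmodule: the lattice
   operations are fields here, and E becomes a latticeType just below. *)
HB.mixin Record POrderedLmodule_isRiesz (R : realType) E
    & Num.POrderedZmodule E & GRing.Lmodule R E := {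
  riesz_meet : E -> E -> E;
  riesz_join : E -> E -> E;
  riesz_meetP : forall x y z : E,
    (x <= riesz_meet y z) = (x <= y) && (x <= z);
  riesz_joinP : forall x y z : E,
    (riesz_join x y <= z) = (x <= z) && (y <= z);
  rieszD2r : forall z x y : E, x <= y -> x + z <= y + z;
  rieszZ_ge0 : forall (a : R) (x : E), 0 <= a -> 0 <= x -> 0 <= a *: x
}.

#[short(type="rieszType")]
HB.structure Definition Riesz (R : realType) :=
  { E of Num.POrderedZmodule E & GRing.Lmodule R E
       & POrderedLmodule_isRiesz R E }.

HB.instance Definition _ (R : realType) (E : rieszType R) :=
  Order.POrder_MeetJoin_isLattice.Build ring_display E
    (@riesz_meetP R E) (@riesz_joinP R E).

Section OrderUnit.
Context {R : realType} {E : rieszType R}.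
Implicit Types (x y u : E) (S C : set E).

Definition archimedean := forall x y, (forall n : nat, y *+ n <= x) -> y <= 0.

Definition order_unit u :=
  0 <= u /\ forall x, 0 <= x -> exists n : nat, x <= u *+ n.

(* The real-valued [inf] is the genuine infimum as soon as E is nonzero and u is
   a unit: the set is then nonempty and bounded below. *)
Definition unit_gauge u x : R := inf [set t : R | x <= t *: u].

Definition Dhu u x y : R :=
  Num.max 0 (unit_gauge u (x - y)) + Num.max 0 (unit_gauge u (y - x)).

(* A lattice E without least element gives no neutral element for joins, so the
   joins (and maxima) of nonempty families are seeded with their first term,
   which is harmless by idempotence. *)
Definition maxplus_hull u S : set E :=
  [set z | exists m (x : 'I_m.+1 -> E) (t : 'I_m.+1 -> R),
    [/\ forall i, S (x i),
        \big[Num.max/t ord0]_(i < m.+1) t i = 0 &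
        z = \big[Order.join/x ord0 + t ord0 *: u]_(i < m.+1)
              (x i + t i *: u)]].

Definition maxplus_convex u C := C = maxplus_hull u C.

End OrderUnit.
Arguments archimedean {R} E.

Section DhuMetric.
Context {R : realType} {E : rieszType R} (u : E).
Hypotheses (archE : archimedean E) (unitu : order_unit u).
Implicit Types (x y z : E) (s t : R).

Let subr_riesz x y : (0 <= y - x) = (x <= y).
Proof.
apply/idP/idP => [/(rieszD2r x)|/(rieszD2r (- x))].
  by rewrite add0r subrK.
by rewrite subrr.
Qed.

Let leD x y z w : x <= y -> z <= w -> x + z <= y + w.
Proof.
move=> xy zw; apply: (le_trans (rieszD2r z _ _ xy)).
by rewrite ![y + _]addrC; exact: rieszD2r.
Qed.

Let leZu s t : s <= t -> s *: u <= t *: u.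
Proof.
move=> st; rewrite -subr_riesz -scalerBl; apply: rieszZ_ge0.
  by rewrite subr_ge0.
exact: unitu.1.
Qed.

Let gauge_set x := [set t : R | x <= t *: u].

Let gauge_set_nonempty x : gauge_set x !=set0.
Proof.
have [n xn] : exists n : nat, Order.join x 0 <= u *+ n.
  by apply: unitu.2; exact: leUr.
by exists n%:R; rewrite /gauge_set /= scaler_nat (le_trans (leUl x 0)).
Qed.

Let unit0_trivial : u = 0 -> forall x y, x = y.
Proof.
move=> u0; have le0 x : x <= 0.
  by have [t] := gauge_set_nonempty x; rewrite /gauge_set /= u0 scaler0.
have ge0 x : 0 <= x by rewrite -subr_riesz subr0 -[x]opprK -sub0r subr_riesz.
have E0 x : x = 0 by apply/le_anti; rewrite le0 ge0.
by move=> x y; rewrite (E0 x) (E0 y).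
Qed.

Let scale_unit_ge0 t : u != 0 -> 0 <= t *: u -> 0 <= t.
Proof.
move=> u0 tu; rewrite leNgt; apply/negP => t0.
move/eqP: u0; apply; apply/le_anti; rewrite unitu.1 andbT.
have := @rieszZ_ge0 R E (- t)^-1 (t *: u).
rewrite invr_ge0 oppr_ge0 ltW// => /(_ isT tu).
rewrite invrN scaleNr scalerA mulVf ?lt_eqF// scale1r.
by rewrite -sub0r subr_riesz.
Qed.

Let gauge_set_has_inf x : u != 0 -> has_inf (gauge_set x).
Proof.
move=> u0; split; first exact: gauge_set_nonempty.
have [m xm] := gauge_set_nonempty (- x).
exists (- m) => t xt; rewrite -subr_ge0 opprK.
by apply: scale_unit_ge0 => //; rewrite scalerDl -(subrr x) leD.
Qed.

Let gauge0 : unit_gauge u 0 = 0.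
Proof.
have [u0|u0] := eqVneq u 0.
  apply: inf_out => -[_ [m]]; rewrite u0 => /(_ (m - 1)).
  rewrite /= scaler0 lexx => /(_ isT).
  by rewrite lerBrDr gerDl ler10.
apply/eqP; rewrite eq_le; apply/andP; split.
  by apply: ge_inf; [exact: (gauge_set_has_inf 0 u0).2|rewrite /= scale0r].
apply: lb_le_inf; first exact: gauge_set_nonempty.
by move=> t /= tu; exact: scale_unit_ge0.
Qed.

Let gaugeD x y : u != 0 ->
  unit_gauge u (x + y) <= unit_gauge u x + unit_gauge u y.
Proof.
move=> u0; apply/ler_addgt0Pr => e e0.
have e20 : 0 < e / 2 by rewrite divr_gt0.
have [s xs se] := inf_adherent e20 (gauge_set_has_inf x u0).
have [t yt te] := inf_adherent e20 (gauge_set_has_inf y u0).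
rewrite [e]splitr addrACA (le_trans _ (lerD (ltW se) (ltW te)))//.
apply: ge_inf; first exact: (gauge_set_has_inf _ u0).2.
by rewrite /= scalerDl leD.
Qed.

Let gauge_le0 x : u != 0 -> unit_gauge u x <= 0 -> x <= 0.
Proof.
move=> u0 x0; apply: (archE (x := u)) => n.
case: n => [|n]; first by rewrite mulr0n unitu.1.
have n0 : 0 < n.+1%:R^-1 :> R by rewrite invr_gt0.
have [t xt tn] := inf_adherent n0 (gauge_set_has_inf x u0).
have xnu : x <= n.+1%:R^-1 *: u.
  by apply: (le_trans xt); apply/leZu/(le_trans (ltW tn)); rewrite gerDr.
rewrite -subr_riesz in xnu; rewrite -subr_riesz.
have := @rieszZ_ge0 R E n.+1%:R _ (ler0n _ _) xnu.
by rewrite scalerBr scalerA divff ?pnatr_eq0// scale1r scaler_nat.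
Qed.

Lemma Dhuxx x : Dhu u x x = 0.
Proof. by rewrite /Dhu subrr gauge0 maxxx addr0. Qed.

Lemma Dhu_sym x y : Dhu u x y = Dhu u y x.
Proof. by rewrite /Dhu addrC. Qed.

Lemma Dhu_positivity x y : Dhu u x y = 0 -> x = y.
Proof.
have [u0 _|u0 /eqP] := eqVneq u 0; first exact: unit0_trivial.
rewrite paddr_eq0 ?le_max ?lexx// => /andP[/eqP xy /eqP yx].
have max0 (t : R) : Num.max 0 t = 0 -> t <= 0.
  by move=> <-; rewrite le_max lexx orbT.
apply/le_anti/andP; split.
- by rewrite -subr_riesz -opprB -sub0r subr_riesz; exact/gauge_le0/max0.
- by rewrite -subr_riesz -opprB -sub0r subr_riesz; exact/gauge_le0/max0.
Qed.

Lemma Dhu_triangle y x z : Dhu u x z <= Dhu u x y + Dhu u y z.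
Proof.
have [u0|u0] := eqVneq u 0.
  have E0 := unit0_trivial u0.
  by rewrite (E0 x 0) (E0 y 0) (E0 z 0) Dhuxx addr0.
have half a b c : Num.max 0 (unit_gauge u (a - c)) <=
    Num.max 0 (unit_gauge u (a - b)) + Num.max 0 (unit_gauge u (b - c)).
  rewrite ge_max addr_ge0 ?le_max ?lexx//=.
  rewrite -(subrK b a) -addrA (le_trans (gaugeD _ _ u0))//.
  by rewrite subrK; apply: lerD; rewrite le_max lexx orbT.
by rewrite /Dhu addrACA lerD// addrC.
Qed.

End DhuMetric.

(* E with the metric, uniformity and topology of Dhu u. *)
Definition huspace {R : realType} {E : rieszType R} {u : E}
  (archE : archimedean E) (unitu : order_unit u) : Type := E.

HB.instance Definition _ {R : realType} {E : rieszType R} {u : E}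
    (archE : archimedean E) (unitu : order_unit u) :=
  Choice.copy (huspace archE unitu) E.

HB.instance Definition _ {R : realType} {E : rieszType R} {u : E}
    (archE : archimedean E) (unitu : order_unit u) :=
  isMetric.Build R (huspace archE unitu)
    (Dhuxx unitu) (Dhu_positivity archE unitu)
    (Dhu_sym u) (Dhu_triangle unitu).

Definition complete_set {R : realType} {T : metricType R} (X : set T) :=
  forall s : nat -> T, (forall n, X (s n)) -> cauchy (s @ \oo) ->
    exists2 l, X l & s @ \oo --> l.

Definition locally_finite {Y : topologicalType} (V : set (set Y)) :=
  forall y : Y, exists2 N, nbhs y N &
    finite_set [set B | V B /\ B `&` N !=set0].

Definition paracompact_space (Y : topologicalType) :=
  hausdorff_space Y /\
  forall U : set (set Y), U `<=` open -> \bigcup_(B in U) B = [set: Y] ->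
    exists V : set (set Y),
      [/\ V `<=` open, \bigcup_(B in V) B = [set: Y],
          (forall B, V B -> exists2 C, U C & B `<=` C) & locally_finite V].

Definition lower_semicontinuous_map {Y X : topologicalType}
    (Gamma : Y -> set X) :=
  forall V : set X, open V -> open [set y | Gamma y `&` V !=set0].

Definition continuous_selection {Y X : topologicalType}
    (Gamma : Y -> set X) (f : Y -> X) :=
  continuous f /\ forall y, Gamma y (f y).

(* Main.v *)
Require Import Defs.
From HB Require Import structures.
From mathcomp Require Import all_boot all_order all_algebra.
From mathcomp Require Import boolp classical_sets functions cardinality.
From mathcomp Require Import reals interval_inference topology normedtype.
From mathcomp Require Import lra.

(** The proof is the one of Michael's selection theorem, with finite joins
    [\join_i (x_i + t_i u)], [max_i t_i = 0], in the role of convex combinations.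

    Distances are measured by the order: [x] and [y] are [e]-close when
    [x <= y + e u] and [y <= x + e u]. This is equivalent, up to a factor 2, to
    the metric [Dhu] ([Dhu_lt_ordclose], [ordclose_Dhu_le]), and a join of
    translates is as well behaved for it as a convex combination is for a norm:
    moving every term by at most [e] moves the join by at most [e]
    ([ordclose_lub]), and balls are stable under such joins.

    A partition of unity is replaced by a locally finite family of bumps [phi_B]
    with values in [[0, 1]] which at every point of [Y] has a member equal to 1
    ([paracompact_bumps]). Take [t_B = 1 - 1 / phi_B]: it is nonpositive,
    vanishes where [phi_B = 1], and tends to minus infinity as [phi_B] tends to
    0. In the presence of an order unit a term [x_B + t_B u] thus drops below the
    join of the others before it disappears, so the join over the [B] with
    [phi_B y > 0] depends continuously on [y]. Choosing [x_B] within [e] of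
    a point of [Phi y] for every [y] in [B] gives a continuous [f] with [f y]
    within [e] of a point of [Phi y] ([approximate_selection]).

    Applying this to [Phi] cut down to balls around an approximate selection
    halves the error while moving the function little ([refine_selection]). The
    successive approximations converge uniformly. The limit takes its values in
    [Phi], because points of [Phi y] chosen near the approximations form a Cauchy
    sequence in the closed set [Phi y] of the complete set [X]
    ([ord_selection], [closed_ord_complete]).

    Finally, a selection [g] given on a closed set [A] is extended by applying
    the result to the map equal to [{g y}] on [A] and to [Gamma] off [A]: it is
    again lower semicontinuous ([override_lsc]), and singletons are max-plus
    convex and complete. Plain existence is the case where [A] is empty. *)

Set Implicit Arguments.
Unset Strict Implicit.
Unset Printing Implicit Defensive.

Local Open Scope classical_set_scope.
Local Open Scope ring_scope.
Import Order.TTheory GRing.Theory Num.Theory.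
Import numFieldNormedType.Exports.

(** * Closeness and finite joins in a Riesz space with an order unit *)

Section OrderUnitCloseness.
Context {R : realType} {E : rieszType R} {u : E}.
Hypothesis unitu : order_unit u.
Implicit Types (x y z : E) (d e s t : R).

Lemma riesz_lerD x y z w : x <= y -> z <= w -> x + z <= y + w.
Proof.
move=> xy zw; apply: (le_trans (rieszD2r z _ _ xy)).
by rewrite ![y + _]addrC; exact: rieszD2r.
Qed.

Lemma riesz_subr_ge0 x y : (0 <= y - x) = (x <= y).
Proof.
apply/idP/idP => [/(rieszD2r x)|/(rieszD2r (- x))].
  by rewrite add0r subrK.
by rewrite subrr.
Qed.

Lemma riesz_lerBlDr x y z : (x - y <= z) = (x <= z + y).
Proof.
by apply/idP/idP => [/(rieszD2r y)|/(rieszD2r (- y))]; rewrite ?subrK ?addrK.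
Qed.

Lemma unit_lerZ s t : s <= t -> s *: u <= t *: u.
Proof.
move=> st; rewrite -riesz_subr_ge0 -scalerBl; apply: rieszZ_ge0.
  by rewrite subr_ge0.
exact: unitu.1.
Qed.

Lemma order_unit_bound x y : exists2 t, 0 <= t & x <= y + t *: u.
Proof.
have [n xyn] := unitu.2 _ (leUr (0 : E) (x - y : E)).
exists n%:R; first exact: ler0n.
rewrite addrC -riesz_lerBlDr scaler_nat; apply: le_trans xyn.
exact: (leUl (x - y : E) (0 : E)).
Qed.

(** The closed ball for the order-unit norm, expressed without the gauge: the
    order form combines directly with joins. *)
Definition ordclose e x y := x <= y + e *: u /\ y <= x + e *: u.

Lemma ordclose_sym e x y : ordclose e x y -> ordclose e y x.
Proof. by case. Qed.

Lemma ordclose_refl e x : 0 <= e -> ordclose e x x.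
Proof.
move=> e0; suff: x <= x + e *: u by [].
by rewrite -{1}[x]addr0; apply: riesz_lerD => //; apply: rieszZ_ge0 unitu.1.
Qed.

Lemma ordclose_trans e d y x z :
  ordclose e x y -> ordclose d y z -> ordclose (e + d) x z.
Proof.
have half (a b c : E) s t :
    a <= b + s *: u -> b <= c + t *: u -> a <= c + (s + t) *: u.
  move=> ab bc; rewrite addrC in ab; apply: (le_trans ab).
  by rewrite addrC scalerDl [s *: u + _]addrC addrA; apply: rieszD2r.
move=> [xy yx] [yz zy]; split; first exact: (half _ _ _ _ _ xy yz).
by rewrite [e + d]addrC; exact: (half _ _ _ _ _ zy yx).
Qed.

Lemma ordclose_le e d x y : e <= d -> ordclose e x y -> ordclose d x y.
Proof.
move=> ed [xy yx].
by split; [apply: (le_trans xy)|apply: (le_trans yx)];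
  apply: riesz_lerD => //; apply: unit_lerZ.
Qed.

(** Least upper bounds are described by their universal property, so that joins
    over finite sets of indices that vary with a point need no enumeration. *)
Definition is_lub (S : set E) z := forall w, z <= w <-> ubound S w.

Lemma is_lub_ub S z x : is_lub S z -> S x -> x <= z.
Proof. by move=> lubz Sx; have /lubz := lexx z; apply. Qed.

Lemma is_lub_shift_le (I : Type) (D : set I) (x y : I -> E) (t : I -> R) e z w :
  (forall i, D i -> x i <= y i + e *: u) ->
  is_lub [set x i + t i *: u | i in D] z ->
  is_lub [set y i + t i *: u | i in D] w -> z <= w + e *: u.
Proof.
move=> xy lubz lubw; apply/lubz => _ [i Di <-].
have yw : y i + t i *: u <= w by apply: (is_lub_ub lubw); exists i.
apply: le_trans (rieszD2r (e *: u) _ _ yw).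
by rewrite addrAC; apply/rieszD2r/xy.
Qed.

(** Translation by [e *: u] is an order automorphism, so it commutes with joins:
    a uniform error on the terms is inherited, without any loss, by the join.
    This is what makes joins of translates as good as convex combinations. *)
Lemma ordclose_lub (I : Type) (D : set I) (x y : I -> E) (t : I -> R) e z w :
  (forall i, D i -> ordclose e (x i) (y i)) ->
  is_lub [set x i + t i *: u | i in D] z ->
  is_lub [set y i + t i *: u | i in D] w -> ordclose e z w.
Proof.
move=> xy lubz lubw; split.
  by apply: (is_lub_shift_le _ lubz lubw) => i /xy[].
by apply: (is_lub_shift_le _ lubw lubz) => i /xy[].
Qed.

(** Max-plus convexity for two points, normalised so that the larger coefficient
    is 0. *)
Definition maxplus_closed (C : set E) :=
  forall x y t, C x -> C y -> t <= 0 -> C (Order.join x (y + t *: u)).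

Lemma maxplus_convex_closed (C : set E) :
  maxplus_convex u C -> maxplus_closed C.
Proof.
move=> convC x y t Cx Cy t0; rewrite convC.
(* The two-term combination with coefficients 0 and [t]. *)
exists 1%N, (fun i => if i == ord0 then x else y).
exists (fun i => if i == ord0 then 0 else t); split.
- by move=> i; case: ifP.
- rewrite big_ord_recl big_ord_recl big_ord0 /= [Num.max t 0]max_r//.
  exact: maxxx.
- rewrite big_ord_recl big_ord_recl big_ord0 /= scale0r addr0.
  by rewrite [X in _ = Order.join x X]joinC joinA joinxx.
Qed.

Lemma maxplus_closed_set1 (x : E) : maxplus_closed [set x].
Proof.
move=> _ _ t -> -> t0 /=; apply: join_l; rewrite -[leRHS]addr0.
by apply: riesz_lerD => //; rewrite -(scale0r u); apply: unit_lerZ.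
Qed.

(** Start from a term with coefficient 0, which lies in [C], and adjoin the other
    terms one by one: each step is a two-point combination. *)
Lemma maxplus_closed_lub (I : choiceType) (C : set E) (D : set I)
    (x : I -> E) (t : I -> R) :
  maxplus_closed C -> finite_set D ->
  (forall i, D i -> C (x i)) -> (forall i, D i -> t i <= 0) ->
  (exists2 i, D i & t i = 0) ->
  exists2 z, C z & is_lub [set x i + t i *: u | i in D] z.
Proof.
move=> Ccl /finite_seqP[s ->] /= Cx t0 [i0 i0s ti0].
(* The induction is on a list [r] that need not contain [i0], which is always
   put in front: the join over the empty list [r] is then [x i0]. *)
have [r [rs sr]] : exists r, {subset r <= s} /\ {subset s <= i0 :: r}.
  by exists s; split=> // i si; rewrite inE si orbT.
have [z Cz lubz] : exists2 z, C z &
    is_lub [set x i + t i *: u | i in [set` i0 :: r]] z.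
  clear sr; elim: r rs => [_|i r IH irs].
    exists (x i0); first exact: Cx.
    move=> w; split=> [xw _ [j + <-]|].
      by rewrite /= inE => /eqP->; rewrite ti0 scale0r addr0.
    by apply; exists i0; rewrite /= ?mem_head// ti0 scale0r addr0.
  have [|z Cz lubz] := IH; first by move=> j jr; apply/irs; rewrite inE jr orbT.
  have si : i \in s by apply: irs; exact: mem_head.
  exists (Order.join z (x i + t i *: u)).
    by apply: Ccl => //; [exact: Cx|exact: t0].
  move=> w; rewrite leUx; split=> [/andP[zw iw] _ [j + <-]|ubw].
    rewrite /= !inE => /or3P[/eqP->|/eqP->|jr] //; last first.
      by move/lubz : zw; apply; exists j; rewrite //= inE jr orbT.
    by move/lubz : zw; apply; exists i0; rewrite //= mem_head.
  apply/andP; split; last by apply: ubw; exists i; rewrite //= !inE eqxx orbT.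
  apply/lubz => _ [j jr <-]; apply: ubw; exists j => //=.
  by move: jr; rewrite /= !inE => /orP[->//|->]; rewrite !orbT.
exists z => //; move=> w; rewrite lubz; split=> ubw _ [j js <-]; apply: ubw.
  by exists j => //=; exact: sr.
by exists j => //=; move: js; rewrite /= inE => /predU1P[->//|/rs].
Qed.

End OrderUnitCloseness.
Arguments ordclose {R E} u.
Arguments maxplus_closed {R E} u.

(** * Paracompact spaces: normality and locally finite bumps *)

Lemma near_finite_set (I : eqType) (T : Type) (F : set_system T) (D : set I)
    (P : I -> set T) : Filter F -> finite_set D ->
  (forall i, D i -> \forall x \near F, P i x) ->
  \forall x \near F, forall i, D i -> P i x.
Proof.
move=> FF /finite_seqP[s ->] /=; elim: s => [_|i s IH Ps].
  by near=> x.
have Ps' : \forall x \near F, forall j, j \in s -> P j x.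
  by apply: IH => j js; apply: Ps; rewrite inE js orbT.
near=> x => j; rewrite inE => /predU1P[->|]; last by move: j; near: x.
by near: x; apply: Ps; exact: mem_head.
Unshelve. all: by end_near. Qed.

Section Paracompact.
Context {Y : topologicalType}.
Implicit Types (A B O : set Y) (V : set (set Y)).

(** Local finiteness reduces a simultaneous eventual property of all the members
    to the property of each member, if it is void outside the member. *)
Lemma locally_finite_near V (P : set Y -> set Y) (y : Y) :
  locally_finite V -> (forall B z, ~ B z -> P B z) ->
  (forall B, V B -> \forall z \near y, P B z) ->
  \forall z \near y, forall B, V B -> P B z.
Proof.
move=> /(_ y)[N Ny finVN] Pout Pnear.
have : \forall z \near y, forall B, (V B /\ B `&` N !=set0) -> P B z.
  by apply: (@near_finite_set _ _ _ _ P _ finVN) => B [VB _]; exact: Pnear.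
move=> PN; near=> z => B VB; have [Bz|/Pout//] := pselect (B z).
have : forall B, (V B /\ B `&` N !=set0) -> P B z by near: z.
by apply; split => //; exists z; split => //; near: z.
Unshelve. all: by end_near. Qed.

(** One step from separating points of [A] from [B] to separating [A] from [B].
    Used twice: with [B] a point it turns Hausdorff into regular, and then with
    [B] closed it turns regular into normal. The open sets that meet [A] in a
    locally finite refinement of the separating cover form the neighbourhood of
    [A]; near a point of [B], only finitely many of them have to be avoided. *)
Lemma paracompact_separate A B : paracompact_space Y -> closed A ->
  (forall a, A a -> exists O G, [/\ open O, open G, O a, B `<=` G &
                                  O `&` G = set0]) ->
  exists O G, [/\ open O, open G, A `<=` O, B `<=` G & O `&` G = set0].
Proof.
move=> [_ para] clA sepA.
pose U := [set O | open O /\ (O `&` A !=set0 ->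
  exists G, [/\ open G, B `<=` G & O `&` G = set0])].
have [||V [Vopen Vcov Vref Vlf]] := para U.
- by move=> O [].
- apply/seteqP; split=> // y _; have [Ay|nAy] := pselect (A y).
    have [O [G [oO oG Oy BG OG]]] := sepA _ Ay.
    by exists O => //; split=> // _; exists G.
  exists (~` A) => //; split; first exact: closed_openC.
  by case=> z [].
pose O := \bigcup_(W in [set W | V W /\ W `&` A !=set0]) W.
exists O, (~` O)°; split.
- by apply: bigcup_open => W [/Vopen].
- exact: open_interior.
- move=> a Aa; have : setT a by [].
  by rewrite -Vcov => -[W VW Wa]; exists W => //; split=> //; exists a.
- move=> b Bb.
  have : \forall z \near b, forall W, V W -> W `&` A !=set0 -> ~ W z.
    apply: (@locally_finite_near V (fun W z => W `&` A !=set0 -> ~ W z)) => //.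
    move=> W VW; have [WA|WA] := pselect (W `&` A !=set0); last by near=> z.
    have [C [oC CG] WC] := Vref _ VW.
    have [|G [oG BG CG0]] := CG.
      by have [z [Wz Az]] := WA; exists z; split => //; exact: WC.
    have Gb : nbhs b G by apply: open_nbhs_nbhs; split=> //; exact: BG.
    near=> z => _ Wz; suff : (C `&` G) z by rewrite CG0.
    by split; [exact: WC|near: z].
  by apply: filterS => z Vz [W [VW WA]]; exact: Vz.
- by apply/seteqP; split=> // z [Oz /interior_subset].
Unshelve. all: by end_near. Qed.

Lemma paracompact_normal : paracompact_space Y ->
  forall A B, closed A -> closed B -> A `&` B = set0 ->
  exists O G, [/\ open O, open G, A `<=` O, B `<=` G & O `&` G = set0].
Proof.
move=> para A B clA clB AB0; apply: paracompact_separate => // a Aa.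
have [||G [O [oG oO BG aO GO]]] := @paracompact_separate B [set a] para => //.
  move=> b Bb; have ba : b != a.
    by apply/eqP => ba; have : (A `&` B) b by [split; rewrite // ba]; rewrite AB0.
  have := para.1; rewrite open_hausdorff => /(_ _ _ ba)[[P Q] /= [Pb Qa] [oP oQ /eqP PQ]].
  exists P, Q; split=> //; first exact: set_mem.
  by move=> _ ->; exact: set_mem.
by exists O, G; split => //; [exact: aO|rewrite setIC].
Qed.

(** The cover is shrunk by refining twice: [V] refines [U], and a second
    refinement [V'] consists of open sets whose closures lie in members of [V].
    The union of those assigned to [B] has, by local finiteness, its closure
    inside [B], and Urysohn's lemma separates it from the complement of [B].
    Since [V'] covers [Y], each point has a bump that equals 1: the family is
    normalised by its maximum rather than by its sum. *)
Lemma paracompact_bumps (R : realType) (U : set (set Y)) :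
  paracompact_space Y -> U `<=` open -> \bigcup_(B in U) B = [set: Y] ->
  exists (V : set (set Y)) (phi : set Y -> Y -> R),
    [/\ locally_finite V, forall B, V B -> exists2 C, U C & B `<=` C,
        forall B, V B -> [/\ continuous (phi B),
          forall y, 0 <= phi B y <= 1 & forall y, ~ B y -> phi B y = 0] &
        forall y, exists2 B, V B & phi B y = 1].
Proof.
move=> para Uopen Ucov; have [V [Vopen Vcov Vref Vlf]] := para.2 U Uopen Ucov.
pose U' := [set O | open O /\ exists2 B, V B & closure O `<=` B].
have [||V' [_ V'cov V'ref V'lf]] := para.2 U'; first by move=> O [].
  apply/seteqP; split=> // y _; have : setT y by [].
  rewrite -Vcov => -[B VB By].
  have cly : closed [set y].
    by apply: accessible_closed_set1; apply: hausdorff_accessible; exact: para.1.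
  have [|O [G [oO oG yO BG OG]]] := paracompact_normal para cly
    (open_closedC (Vopen _ VB)).
    by apply/seteqP; split=> // z [-> /=].
  exists O; last exact: yO.
  split=> //; exists B => // z Oz; apply: contrapT => /BG Gz.
  have [|w [Ow Gw]] := Oz G; first exact: open_nbhs_nbhs.
  by have : (O `&` G) w by []; rewrite OG.
pose F B := closure (\bigcup_(O in [set O | V' O /\ closure O `<=` B]) O).
have FB B : F B `<=` B.
  move=> y Fy; apply: contrapT => nBy.
  have near_out : \forall z \near y, forall O, V' O -> closure O `<=` B -> ~ O z.
    apply: (@locally_finite_near V' (fun O z => closure O `<=` B -> ~ O z)) => //.
    move=> O V'O; have [OB|OB] := pselect (closure O `<=` B); last by near=> z.
    have : (~` O)° y by rewrite interiorC => /OB.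
    by apply: filterS => z nOz _.
  have [z [[O [V'O OB] Oz]]] := Fy _ near_out.
  by move/(_ _ V'O OB).
have bump B : exists f : Y -> R, V B -> [/\ continuous f,
    forall y, 0 <= f y <= 1, forall y, ~ B y -> f y = 0 &
    forall y, F B y -> f y = 1].
  have [VB|nVB] := pselect (V B); last by exists (fun=> 0).
  have sep : uniform_separator (~` B) (F B).
    apply: ((@normal_separatorP R Y).1 ((@normal_openP R Y).2 (paracompact_normal para))).
    - by apply: open_closedC; exact: Vopen.
    - exact: closed_closure.
    - by apply/seteqP; split=> // z [nBz /FB].
  have [f [cf f01 f0 f1]] := (@uniform_separatorP _ R _ _).1 sep.
  exists f => _; split=> // y.
  - have fy : range f (f y) by exists y.
    by have := f01 _ fy; rewrite /= in_itv.
  - by move=> nBy; apply: f0; exists y.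
  - by move=> Fy; apply: f1; exists y.
have [phi phiP] := choice bump.
exists V, phi; split=> //; first by move=> B /phiP[].
move=> y; have : setT y by [].
rewrite -V'cov => -[O V'O Oy]; have [C [_ [B VB CB]] OC] := V'ref _ V'O.
exists B => //; have [_ _ _ phi1] := phiP _ VB; apply/phi1/subset_closure.
by exists O => //; split=> //; apply: subset_trans CB; exact: closureS.
Unshelve. all: by end_near. Qed.

End Paracompact.

(** * Approximate selections *)

Section Selection.
Context {R : realType} {E : rieszType R} {u : E} {Y : topologicalType}.
Hypothesis unitu : order_unit u.
Implicit Types (Phi : Y -> set E) (f : Y -> E).

(** Lower semicontinuity and continuity are stated in [E] itself, because an
    approximate selection need not take its values among those of [Phi]. *)
Definition ord_lsc Phi := forall y z, Phi y z -> forall e : R, 0 < e ->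
  \forall y' \near y, exists2 z', Phi y' z' & ordclose u e z z'.

Definition ord_continuous f := forall y (e : R), 0 < e ->
  \forall y' \near y, ordclose u e (f y) (f y').

(** A rational substitute for the logarithm on the positive reals: increasing,
    0 at 1, and tending to minus infinity at 0 from the right. *)
Definition weight (a : R) := 1 - a^-1.

Lemma weight_near (phi : Y -> R) (y : Y) (d : R) :
  continuous phi -> 0 < phi y -> 0 < d ->
  \forall y' \near y, [/\ 0 < phi y', weight (phi y') <= weight (phi y) + d &
                       weight (phi y) <= weight (phi y') + d].
Proof.
move=> cphi phi0 d0.
have cinv : (phi y')^-1 @[y' --> y] --> (phi y)^-1.
  by apply: cvgV; [rewrite gt_eqF|exact: cphi].
have near_inv : \forall y' \near y, `|(phi y)^-1 - (phi y')^-1| < d.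
  by move/cvgrPdist_lt : cinv; apply.
have near_pos : \forall y' \near y, 0 < phi y'.
  exact: (cvgr_gt _ (cphi y)).
near=> y'; have : `|(phi y)^-1 - (phi y')^-1| < d by near: y'.
rewrite ltr_norml => /andP[d1 d2]; split; first by near: y'.
- by rewrite /weight; lra.
- by rewrite /weight; lra.
Unshelve. all: by end_near. Qed.

Lemma weight_near0 (phi : Y -> R) (y : Y) (K : R) :
  continuous phi -> phi y = 0 -> 0 <= K ->
  \forall y' \near y, 0 < phi y' -> weight (phi y') <= - K.
Proof.
move=> cphi phi0 K0; have K1 : 0 < K + 1 by lra.
have : \forall y' \near y, phi y' < (K + 1)^-1.
  by apply: (cvgr_lt _ (cphi y)); rewrite phi0 invr_gt0.
apply: filterS => y' small pos; rewrite /weight.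
have : K + 1 <= (phi y')^-1.
  by rewrite -[K + 1]invrK lef_pV2 ?posrE ?invr_gt0//; exact: ltW.
lra.
Qed.

Lemma weight_le0 (a : R) : 0 < a -> a <= 1 -> weight a <= 0.
Proof. by move=> a0 a1; rewrite /weight subr_le0 invf_ge1. Qed.

(** The join of the [x B + weight (phi B y) *: u] over the bumps that are positive
    at [y]. All the [x B] involved are [e]-close to points [z B] of [Phi y], and
    the join of the latter with the same weights belongs to [Phi y]. *)
Lemma approximate_selection Phi (e : R) : paracompact_space Y ->
  ord_lsc Phi -> (forall y, Phi y !=set0) ->
  (forall y, maxplus_closed u (Phi y)) -> 0 < e ->
  exists2 f, ord_continuous f &
    forall y, exists2 z, Phi y z & ordclose u e (f y) z.
Proof.
move=> para lsc Phi0 Phicl e0.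
pose U := [set O : set Y | open O /\ exists x, forall y, O y ->
  exists2 z, Phi y z & ordclose u e x z].
have [||V [phi [Vlf Vref phiP phi1]]] := paracompact_bumps R para (U := U).
- by move=> O [].
- apply/seteqP; split=> // y _; have [x Phix] := Phi0 y.
  have := lsc _ _ Phix _ e0; rewrite /prop_near1 nbhsE => -[O [oO Oy] OP].
  by exists O => //; split=> //; exists x.
have /choice[x xP] : forall B, exists x, V B -> forall y, B y ->
    exists2 z, Phi y z & ordclose u e x z.
  move=> B; have [/Vref[C [_ [x xC]] BC]|nVB] := pselect (V B).
    by exists x => _ y /BC /xC.
  by exists 0.
pose D y := [set B | V B /\ 0 < phi B y].
pose t y B := weight (phi B y).
have phi_mem B y : V B -> 0 < phi B y -> B y.
  move=> VB pos; apply: contrapT => /(let: And3 _ _ p := phiP _ VB in p y) p0.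
  by rewrite p0 ltxx in pos.
have finD y : finite_set (D y).
  have [N Ny] := Vlf y; apply: sub_finite_set => B [VB pos]; split=> //.
  exists y; split; first exact: phi_mem.
  exact: nbhs_singleton.
have t_le0 y B : D y B -> t y B <= 0.
  move=> [VB pos]; apply: weight_le0 => //.
  by have [_ /(_ y)/andP[]] := phiP _ VB.
have t_eq0 y : exists2 B, D y B & t y B = 0.
  have [B VB phiB] := phi1 y; exists B; first by split; rewrite // phiB.
  by rewrite /t /weight phiB invr1 subrr.
have /choice[f fP] : forall y, exists z,
    is_lub [set x B + t y B *: u | B in D y] z.
  move=> y; have closedT : maxplus_closed u [set: E] by [].
  have [z _ lubz] := maxplus_closed_lub (x := x) closedT (finD y) (fun _ _ => I)
    (t_le0 y) (t_eq0 y).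
  by exists z.
have f_ub y B : D y B -> x B + t y B *: u <= f y.
  by move=> DB; apply: (is_lub_ub (fP y)); exists B.
exists f => [y d d0|y].
  (* Lower estimate: only the finitely many terms present at [y] matter, and
     each of them varies continuously. *)
  have near_ge : \forall y' \near y, f y <= f y' + d *: u.
    have near_D : \forall y' \near y, forall B, V B -> 0 < phi B y ->
        x B + t y B *: u <= f y' + d *: u.
      have near_D : \forall y' \near y, forall B, D y B ->
          x B + t y B *: u <= f y' + d *: u.
        apply: near_finite_set => // B [VB pos].
        have [cphi _ _] := phiP _ VB.
        apply: filterS (weight_near cphi pos d0) => y' [pos' _ ty].
        have : x B + t y B *: u <= x B + (t y' B + d) *: u.
          by apply: riesz_lerD => //; exact: unit_lerZ.
        move=> /le_trans; apply; rewrite scalerDl addrA; apply: rieszD2r.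
        by apply: f_ub; split.
      by apply: filterS near_D => y' near_D B VB pos; exact: near_D.
    apply: filterS near_D => y' near_D; apply/fP => _ [B [VB pos] <-].
    exact: near_D.
  (* Upper estimate: the terms that appear near [y] without being present at
     [y] have a weight too negative to exceed [f y + d *: u]. *)
  have near_le : \forall y' \near y, f y' <= f y + d *: u.
    have near_D : \forall y' \near y, forall B, V B -> B y' ->
        0 < phi B y' -> x B + t y' B *: u <= f y + d *: u.
      apply: (locally_finite_near (P := fun B y' => B y' -> 0 < phi B y' ->
        x B + t y' B *: u <= f y + d *: u) Vlf) => // B VB.
      have [cphi /(_ y)/andP[phi0 _] _] := phiP _ VB.
      have [pos|] := ltP 0 (phi B y).
        apply: filterS (weight_near cphi pos d0) => y' [_ ty' _] _ _.
        have : x B + t y' B *: u <= x B + (t y B + d) *: u.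
          by apply: riesz_lerD => //; exact: unit_lerZ.
        move=> /le_trans; apply; rewrite scalerDl addrA; apply: rieszD2r.
        by apply: f_ub; split.
      move=> phi0'; have phiy0 : phi B y = 0.
        by apply/le_anti; rewrite phi0' phi0.
      have [K K0 xK] := order_unit_bound unitu (x B) (f y + d *: u).
      apply: filterS (weight_near0 cphi phiy0 K0) => y' ty' _ /ty' {}ty'.
      have : x B + t y' B *: u <= (f y + d *: u + K *: u) + (- K) *: u.
        by apply: riesz_lerD => //; exact: unit_lerZ.
      by rewrite scaleNr addrK.
    apply: filterS near_D => y' near_D; apply/fP => _ [B [VB pos] <-].
    by apply: near_D => //; exact: phi_mem.
  by near=> y'; split; near: y'.
have /choice[z zP] : forall B, exists z, D y B ->
    Phi y z /\ ordclose u e (x B) z.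
  move=> B; have [[VB pos]|nDB] := pselect (D y B); last by exists 0.
  by have [z Phiz xz] := xP _ VB _ (phi_mem _ _ VB pos); exists z.
have [w Phiw lubw] := maxplus_closed_lub (Phicl y) (finD y)
  (fun B DB => (zP B DB).1) (t_le0 y) (t_eq0 y).
exists w => //; apply: (ordclose_lub _ (fP y) lubw) => B DB.
exact: (zP B DB).2.
Unshelve. all: by end_near. Qed.


(** Apply the previous lemma, with error [e / 2], to the values of [Phi] within
    [2 * e] of [f]. *)
Lemma refine_selection Phi f (e : R) : paracompact_space Y ->
  ord_lsc Phi -> (forall y, maxplus_closed u (Phi y)) -> 0 < e ->
  ord_continuous f ->
  (forall y, exists2 z, Phi y z & ordclose u e (f y) z) ->
  exists f', [/\ ord_continuous f',
    forall y, exists2 z, Phi y z & ordclose u (e / 2) (f' y) z &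
    forall y, ordclose u (3 * e) (f y) (f' y)].
Proof.
move=> para lsc Phicl e0 cf fPhi.
(* Asking for some radius [d < 2 * e] makes the balls open, which is what lower
   semicontinuity of [Phi'] requires. *)
pose Phi' y := [set z | Phi y z /\ exists2 d, d < 2 * e & ordclose u d (f y) z].
have lsc' : ord_lsc Phi'.
  move=> y z [Phiz [d de fz]] r r0.
  pose m := Num.min r ((2 * e - d) / 3).
  have m0 : 0 < m by rewrite lt_min r0 /=; lra.
  have mr : m <= r by rewrite /m ge_min lexx.
  have md : m <= (2 * e - d) / 3 by rewrite /m ge_min lexx orbT.
  have near_f := cf y _ m0; have near_Phi := lsc _ _ Phiz _ m0.
  near=> y'; have [z' Phiz' zz'] : exists2 z', Phi y' z' & ordclose u m z z'.
    by near: y'.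
  exists z'; last exact: ordclose_le zz'.
  split=> //; exists (m + d + m); first by lra.
  apply: (ordclose_trans _ zz'); apply: ordclose_trans fz.
  by apply: ordclose_sym; near: y'.
have Phi'0 y : Phi' y !=set0.
  by have [z Phiz fz] := fPhi y; exists z; split=> //; exists e => //; lra.
have Phi'cl y : maxplus_closed u (Phi' y).
  move=> x z t [Phix [d1 d1e fx]] [Phiz [d2 d2e fz]] t0.
  split; first exact: Phicl.
  exists (Num.max d1 d2); first by rewrite gt_max d1e.
  have [fx1 fx2] : ordclose u (Num.max d1 d2) (f y) x.
    by apply: ordclose_le fx => //; rewrite le_max lexx.
  have [_ fz2] : ordclose u (Num.max d1 d2) (f y) z.
    by apply: ordclose_le fz => //; rewrite le_max lexx orbT.
  split.
    by apply: (le_trans fx1); apply: rieszD2r; exact: leUl.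
  rewrite leUx fx2 /=; apply: le_trans fz2; rewrite -[leRHS]addr0.
  by apply: riesz_lerD => //; rewrite -(scale0r u); exact: unit_lerZ.
have e20 : 0 < e / 2 by lra.
have [f' cf' f'Phi] := approximate_selection para lsc' Phi'0 Phi'cl e20.
exists f'; split=> // y; have [z [Phiz [d de fz]] f'z] := f'Phi y.
  by exists z.
apply: (@ordclose_le _ _ _ unitu (d + e / 2)); first by lra.
exact: ordclose_trans fz (ordclose_sym f'z).
Unshelve. all: by end_near. Qed.

Lemma selection_sequence Phi : paracompact_space Y ->
  ord_lsc Phi -> (forall y, Phi y !=set0) ->
  (forall y, maxplus_closed u (Phi y)) ->
  exists g : nat -> Y -> E, forall n, [/\ ord_continuous (g n),
    forall y, exists2 z, Phi y z & ordclose u (2 ^- n) (g n y) z &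
    forall y, ordclose u (3 * 2 ^- n) (g n y) (g n.+1 y)].
Proof.
move=> para lsc Phi0 Phicl.
pose good n f := ord_continuous f /\
  forall y, exists2 z, Phi y z & ordclose u (2 ^- n) (f y) z.
have /choice[next nextP] : forall p : nat * (Y -> E), exists f', good p.1 p.2 ->
    good p.1.+1 f' /\ forall y, ordclose u (3 * 2 ^- p.1) (p.2 y) (f' y).
  move=> [n f] /=; have [[cf fPhi]|ngood] := pselect (good n f); last by exists f.
  have e0 : 0 < 2 ^- n :> R by rewrite invr_gt0 exprn_gt0.
  have [f' [cf' f'Phi ff']] := refine_selection para lsc Phicl e0 cf fPhi.
  exists f' => _; split; last exact: ff'.
  by split; [exact: cf'|rewrite exprSr invfM].
have [g0 g0c g0Phi] := approximate_selection para lsc Phi0 Phicl ltr01.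
pose g := nat_rect (fun=> Y -> E) g0 (fun n f => next (n, f)).
have g_good n : good n (g n).
  elim: n => [|n IH]; first by split=> //; rewrite expr0 invr1.
  exact: (nextP (n, g n) IH).1.
by exists g => n; have [cg gPhi] := g_good n; split=> //; exact: (nextP (n, g n) _).2.
Qed.

(** * Passage to the limit *)

Definition ord_complete (C : set E) := forall s : nat -> E,
  (forall n, C (s n)) ->
  (forall e : R, 0 < e -> exists N, forall m n,
     (N <= m)%N -> (N <= n)%N -> ordclose u e (s m) (s n)) ->
  exists2 l, C l & forall e : R, 0 < e ->
    exists N, forall n, (N <= n)%N -> ordclose u e (s n) l.

(** The limit at [y] is that of points [z (y, n)] of [Phi y] near [g n y], and not
    that of the [g n y], which may lie outside the complete set. *)
Lemma ord_selection Phi : paracompact_space Y ->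
  ord_lsc Phi -> (forall y, Phi y !=set0) ->
  (forall y, maxplus_closed u (Phi y)) -> (forall y, ord_complete (Phi y)) ->
  exists2 f, ord_continuous f & forall y, Phi y (f y).
Proof.
move=> para lsc Phi0 Phicl Phicomp.
have [g gP] := selection_sequence para lsc Phi0 Phicl.
have pow0 n : 0 < 2 ^- n :> R by rewrite invr_gt0 exprn_gt0.
have powS n : 2 ^- n.+1 = 2 ^- n / 2 :> R by rewrite exprSr invfM mulrC.
have pow_le m n : (m <= n)%N -> 2 ^- n <= 2 ^- m :> R.
  by move=> mn; rewrite lef_pV2 ?posrE ?exprn_gt0// ler_weXn2l// ler1n.
have pow_small (e : R) : 0 < e -> exists n, 2 ^- n < e.
  move=> e0; have [N _ NP] := near_infty_natSinv_expn_lt (PosNum e0).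
  by exists N; have := NP N (leqnn N); rewrite /= div1r.
(* The tail of the geometric series of the steps [3 * 2 ^- i], [n <= i < n + k]. *)
have gg n k y : ordclose u (6 * 2 ^- n - 6 * 2 ^- (n + k)) (g n y) (g (n + k)%N y).
  elim: k => [|k IH]; first by rewrite addn0 subrr; exact: ordclose_refl.
  have [_ _ /(_ y) step] := gP (n + k)%N; rewrite addnS.
  apply: ordclose_le (ordclose_trans IH step) => //.
  by rewrite powS; lra.
have /choice[z zP] : forall p : Y * nat, exists z,
    Phi p.1 z /\ ordclose u (2 ^- p.2) (g p.2 p.1) z.
  move=> [y n] /=; have [_ gPhi _] := gP n.
  by have [z ? ?] := gPhi y; exists z.
have gz y n m : (n <= m)%N -> ordclose u (7 * 2 ^- n) (g n y) (z (y, m)).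
  move=> nm; have := gg n (m - n)%N y; rewrite subnKC// => gnm.
  apply: ordclose_le (ordclose_trans gnm (zP (y, m)).2) => //=.
  by have := pow0 m; have := pow_le _ _ nm; lra.
have /choice[f fP] : forall y, exists l, Phi y l /\
    forall n, ordclose u (8 * 2 ^- n) (g n y) l.
  move=> y; have [n|e e0|l Phil lim] := Phicomp y (fun n => z (y, n)).
  - exact: (zP (y, n)).1.
  - have e14 : 0 < e / 14 by lra.
    have [N Ne] := pow_small _ e14; exists N => m n Nm Nn.
    apply: ordclose_le (ordclose_trans (ordclose_sym (gz y _ _ Nm)) (gz y _ _ Nn)) => //.
    by lra.
  - exists l; split=> // n; have [N NP] := lim _ (pow0 n).
    have nm : (n <= maxn n N)%N by exact: leq_maxl.
    have Nm : (N <= maxn n N)%N by exact: leq_maxr.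
    apply: ordclose_le (ordclose_trans (gz y _ _ nm) (NP _ Nm)) => //.
    by have := pow0 n; lra.
exists f => [y e e0|y]; last exact: (fP y).1.
(* The limit is [8 * 2 ^- n]-close to [g n] at both points, and [g n] varies by
   at most [2 ^- n]. *)
have e17 : 0 < e / 17 by lra.
have [n ne] := pow_small _ e17; have [cg _ _] := gP n.
have near_g := cg y _ (pow0 n); apply: filterS near_g => y' gyy'.
have := ordclose_trans (ordclose_trans (ordclose_sym ((fP y).2 n)) gyy')
  ((fP y').2 n).
by apply: ordclose_le => //; lra.
Qed.

End Selection.

(** * Comparison with the metric topology *)

Section Topology.
Context {R : realType} {E : rieszType R} {u : E}.
Variables (archE : archimedean E) (unitu : order_unit u).
Implicit Types (X : set (huspace archE unitu)).

Lemma gauge_set_neq0 (x : E) : [set t : R | x <= t *: u] !=set0.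
Proof.
have [t _ xt] := order_unit_bound unitu x 0.
by exists t; rewrite /= -[t *: u]add0r.
Qed.

(** Each gauge is bounded by the sum of the two nonnegative parts. *)
Lemma Dhu_lt_ordclose (e : R) (x y : E) : Dhu u x y < e -> ordclose u e x y.
Proof.
have half (a b : E) : unit_gauge u (a - b) < e -> a <= b + e *: u.
  move=> /(inf_lt (gauge_set_neq0 _))[t /= abt te].
  rewrite addrC -riesz_lerBlDr; apply: (le_trans abt).
  by apply: unit_lerZ => //; exact: ltW.
rewrite /Dhu => De; have [a0 b0] : 0 <= Num.max 0 (unit_gauge u (x - y)) /\
  0 <= Num.max 0 (unit_gauge u (y - x)) by rewrite !le_max lexx.
split; apply: half.
  have : unit_gauge u (x - y) <= Num.max 0 (unit_gauge u (x - y)).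
    by rewrite le_max lexx orbT.
  by lra.
have : unit_gauge u (y - x) <= Num.max 0 (unit_gauge u (y - x)).
  by rewrite le_max lexx orbT.
by lra.
Qed.

Lemma ordclose_Dhu_le (e : R) (x y : E) :
  0 <= e -> ordclose u e x y -> Dhu u x y <= 2 * e.
Proof.
move=> e0; have half (a b : E) : a <= b + e *: u ->
    Num.max 0 (unit_gauge u (a - b)) <= e.
  move=> ab; rewrite ge_max e0 /=.
  have abe : a - b <= e *: u by rewrite riesz_lerBlDr addrC.
  (* A set without lower bound has [inf] equal to 0 by convention. *)
  have [lb|nlb] := pselect (has_lbound [set t : R | a - b <= t *: u]).
    exact: ge_inf.
  by rewrite /unit_gauge inf_out// => -[].
by move=> [/half xy /half yx]; rewrite /Dhu; lra.
Qed.

Lemma ordclose_ball (x y : huspace archE unitu) (e : R) :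
  0 < e -> ordclose u (e / 3) x y -> ball x e y.
Proof.
move=> e0 xy; rewrite ballEmdist /=.
have e3 : 0 <= e / 3 by lra.
have De : Dhu u x y < e.
  by apply: le_lt_trans (ordclose_Dhu_le e3 xy) _; lra.
exact: De.
Qed.

Lemma nbhs_ordcloseP (x : huspace archE unitu) (P : set (huspace archE unitu)) :
  nbhs x P <-> exists2 e : R, 0 < e & forall y, ordclose u e x y -> P y.
Proof.
rewrite -nbhs_ballE; split=> [[e /= e0 eP]|[e e0 eP]].
  exists (e / 3); first by lra.
  by move=> y xy; apply/eP/ordclose_ball.
exists e => //= y; rewrite ballEmdist => xy; apply: eP.
exact: Dhu_lt_ordclose.
Qed.

Lemma nbhs_subtypeP X (x : X) (P : set X) :
  nbhs x P <-> exists2 e : R, 0 < e &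
    forall y : X, ordclose u e (set_val x) (set_val y) -> P y.
Proof.
split.
  rewrite nbhsE => -[_ [[O oO <-] /= Ox] OP].
  have /nbhs_ordcloseP[e e0 eO] : nbhs (set_val x) O by apply: open_nbhs_nbhs.
  by exists e => // y xy; apply: OP; exact: eO.
move=> [e e0 eP]; pose B := [set z | ordclose u e (set_val x) z].
have : nbhs (set_val x : huspace archE unitu) B.
  by apply/nbhs_ordcloseP; exists e.
rewrite !nbhsE => -[O [oO Ox] OB]; exists (set_val @^-1` O).
  by split=> //; exists O.
by move=> y /OB; exact: eP.
Qed.

Lemma continuous_ordP (Z : topologicalType) X (f : Z -> X) :
  continuous f <-> forall z (e : R), 0 < e ->
    \forall z' \near z, ordclose u e (set_val (f z)) (set_val (f z')).
Proof.
split=> [cf z e e0|cf z P /nbhs_subtypeP[e e0 eP]].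
  have : nbhs (f z) [set x | ordclose u e (set_val (f z)) (set_val x)].
    by apply/nbhs_subtypeP; exists e.
  by move=> /(cf z).
by apply: filterS (cf z _ e0) => z'; exact: eP.
Qed.

Lemma lower_semicontinuous_ord_lsc (Y : topologicalType) X (Gamma : Y -> set X) :
  lower_semicontinuous_map Gamma ->
  ord_lsc (u := u) (fun y => set_val @` Gamma y).
Proof.
move=> lsc y _ [x Gx <-] e e0.
pose V := [set x' : X | ordclose u e (set_val x) (set_val x')]°.
have Vx : V x by apply/nbhs_subtypeP; exists e.
have : nbhs y [set y' | Gamma y' `&` V !=set0].
  by apply: open_nbhs_nbhs; split; [apply/lsc/open_interior|exists x].
apply: filterS => y' [x' [Gx' Vx']].
by exists (set_val x'); [exists x'|exact: (interior_subset Vx')].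
Qed.

Lemma closed_ord_complete X (C : set X) : complete_set X -> closed C ->
  ord_complete (u := u) (set_val @` C).
Proof.
move=> complX clC s Cs s_cauchy.
have Xs n : X (s n) by have [x _ <-] := Cs n; exact: set_valP.
have [|l Xl sl] := complX s Xs.
  apply/cauchy_exP => e e0.
  have e3 : 0 < e / 3 by lra.
  have [N NP] := s_cauchy _ e3; exists (s N), N => // n /= Nn.
  by apply: ordclose_ball => //; exact: NP.
have lim e : 0 < e -> exists N, forall n, (N <= n)%N -> ordclose u e (s n) l.
  move=> e0; have [N _ NP] : \forall n \near \oo, ordclose u e l (s n).
    by apply: sl; apply/nbhs_ordcloseP; exists e.
  by exists N => n Nn; apply: ordclose_sym; exact: NP.
exists l => //; exists (SigSub (mem_set Xl)) => //; apply: clC => P.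
move=> /nbhs_subtypeP[e e0 eP]; have [N NP] := lim _ e0.
have [x Cx xs] := Cs N; exists x; split=> //; apply: eP.
by rewrite xs; apply: ordclose_sym; exact: NP.
Qed.

Lemma ord_complete1 (x : E) : ord_complete (u := u) [set x].
Proof.
move=> s sx _; exists x => // e e0; exists 0%N => n _.
by rewrite (sx n); apply: (ordclose_refl unitu); exact: ltW.
Qed.

End Topology.

(** * Prescribing values on a closed set *)

Section Extension.
Context {R : realType} {E : rieszType R} {u : E} {Y : topologicalType}.
Variables (A : set Y) (g : A -> E) (Phi : Y -> set E).

(** [{g y}] on [A] and [Phi y] off [A], written without a case distinction. *)
Definition override y := [set z | Phi y z /\ forall a : A, set_val a = y -> z = g a].

Lemma override_in (a : A) : Phi (set_val a) (g a) ->
  override (set_val a) = [set g a].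
Proof.
move=> Pa; apply/seteqP; split=> [z [_ /(_ a erefl)]//|_ ->].
by split=> // b /val_inj ->.
Qed.

Lemma override_out y : ~ A y -> override y = Phi y.
Proof.
move=> nAy; apply/seteqP; split=> [z []//|z Pz]; split=> // a ay.
by case: nAy; rewrite -ay; exact: set_valP.
Qed.

(** At a point of [A], nearby points of [A] are handled by the continuity of [g]
    and the others by the lower semicontinuity of [Phi], since [g y] is a
    value of [Phi y]; off [A], the values are locally those of [Phi]. *)
Lemma override_lsc : closed A -> ord_lsc (u := u) Phi ->
  (forall a, Phi (set_val a) (g a)) ->
  (forall (a : A) (e : R), 0 < e ->
    \forall b \near a, ordclose u e (g a) (g b)) ->
  ord_lsc (u := u) override.
Proof.
move=> clA lsc Pg cg y z [Pz gz] e e0; have := lsc _ _ Pz _ e0 => near_Phi.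
have near_g : \forall y' \near y, forall a : A,
    set_val a = y' -> ordclose u e z (g a).
  have [Ay|nAy] := pselect (A y); last first.
    have : nbhs y (~` A) by apply: open_nbhs_nbhs; split=> //; exact: closed_openC.
    apply: filterS => y' nAy' a ay'; case: nAy'.
    by rewrite -ay'; exact: set_valP.
  pose a : A := SigSub (mem_set Ay).
  rewrite (gz a erefl); have := cg a _ e0; rewrite /prop_near1 nbhsE.
  move=> [_ [[O oO <-] /= Oa] OP].
  exists O; first by split.
  move=> y' Oy' b by'; apply: (OP b).
  by rewrite /= by'.
near=> y'; have [Ay'|nAy'] := pselect (A y').
  pose a : A := SigSub (mem_set Ay').
  exists (g a).
    by have : override (set_val a) (g a) by rewrite (override_in (Pg a)).
  suff : forall a : A, set_val a = y' -> ordclose u e z (g a) by apply.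
  by near: y'.
rewrite override_out//; near: y'; exact: near_Phi.
Unshelve. all: by end_near. Qed.

End Extension.

(* X, A and their subsets live in the subtypes (set_type) of the ambient
   spaces, with the induced topologies. *)
Theorem theorem3 (R : realType) (E : rieszType R)
    (E_neq0 : exists x : E, x != 0) (archE : archimedean E)
    (u : E) (unitu : order_unit u)
    (X : set (huspace archE unitu))
    (convX : maxplus_convex u X) (complX : complete_set X)
    (Y : topologicalType) (paraY : paracompact_space Y)
    (Gamma : Y -> set X) (lscG : lower_semicontinuous_map Gamma)
    (G_neq0 : forall y, Gamma y !=set0)
    (G_closed : forall y, closed (Gamma y))
    (G_conv : forall y, maxplus_convex u (set_val @` Gamma y)) :
  (exists f : Y -> X, continuous_selection Gamma f) /\
  (forall A : set Y, closed A ->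
   forall g : A -> X,
     continuous_selection (fun a : A => Gamma (set_val a)) g ->
     exists f : Y -> X,
       continuous_selection Gamma f /\ forall a : A, f (set_val a) = g a).
Proof.
have extend (A : set Y) (g : A -> X) : closed A ->
    continuous_selection (fun a : A => Gamma (set_val a)) g ->
    exists f : Y -> X,
      continuous_selection Gamma f /\ forall a : A, f (set_val a) = g a.
  move=> clA [cg Gg]; pose Phi y : set E := set_val @` Gamma y.
  pose h (a : A) : E := set_val (g a).
  have Phih a : Phi (set_val a) (h a) by exists (g a).
  have overE y : (exists2 a, y = set_val a & override h Phi y = [set h a]) \/
      override h Phi y = Phi y.
    have [Ay|nAy] := pselect (A y); last by right; exact: override_out.
    pose a : A := SigSub (mem_set Ay); left; exists a => //.
    exact: (override_in (Phih a)).
  have [||||f cf fPhi] := @ord_selection _ _ _ _ unitu (override h Phi) paraY.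
  - apply: override_lsc => //; first exact: lower_semicontinuous_ord_lsc.
    exact: (continuous_ordP g).1.
  - move=> y; have [[a _ ->]|->] := overE y; first by exists (h a).
    by have [x Gx] := G_neq0 y; exists (set_val x), x.
  - move=> y; have [[a _ ->]|->] := overE y; first exact: maxplus_closed_set1.
    exact: maxplus_convex_closed (G_conv y).
  - move=> y; have [[a _ ->]|->] := overE y; first exact: ord_complete1.
    by apply: closed_ord_complete; [exact: complX|exact: G_closed].
  have /choice[F FP] : forall y, exists x : X, Gamma y x /\ set_val x = f y.
    by move=> y; have [[x Gx xf] _] := fPhi y; exists x.
  exists F; split.
    split=> [|y]; last exact: (FP y).1.
    apply/continuous_ordP => y e e0; have := cf y _ e0.
    by apply: filterS => y'; rewrite !(FP _).2.
  move=> a; apply: val_inj; rewrite -[RHS]((fPhi (set_val a)).2 a erefl).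
  exact: (FP _).2.
split; last by move=> A clA g; exact: extend.
pose g0 (a : (set0 : set Y)) : X := False_rect _ (set_valP a).
have [|f [fsel _]] := extend set0 g0 (@closed0 _); last by exists f.
by split=> a; have := set_valP a.
Qed.
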